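(* There is a constant $c$ independent of $f$ and $n$ such that for all integers $n\ge 2$ the operator norm of $S_n: C(\overline{\Omega}_H)\to C(\overline{\Omega}_H)$ (with respect to the uniform norm on $\overline{\Omega}_H$) satisfies $$\|S_n\|_\infty\le c(\log n)^3 .$$
   Context: Let $\mathbb R^4_H=\{\mathbf t\in\mathbb R^4: t_1+t_2+t_3+t_4=0\}$, equipped with its 3-dimensional Lebesgue measure $d\mathbf t$, and $\mathbb Z^4_H=\mathbb Z^4\cap\mathbb R^4_H$. Let $\Omega_H=\{\mathbf t\in\mathbb R^4_H: -1<t_i-t_j\le 1,\ 1\le i<j\le 4\}$ (a rhombic dodecahedron, of volume $2$), with closure $\overline\Omega_H$. A function $f$ on $\mathbb R^4_H$ is called $H$-periodic if $f(\mathbf t+\mathbf k)=f(\mathbf t)$ for all $\mathbf k\in\mathbb Z^4_H$; functions on $\overline\Omega_H$ are identified with their $H$-periodic extensions. Let $\mathbb H=\{\mathbf k\in\mathbb Z^4_H: k_1\equiv k_2\equiv k_3\equiv k_4 \pmod 4\}$, $\phi_{\mathbf k}(\mathbf t)=e^{\frac{\pi i}{2}\mathbf k\cdot\mathbf t}$, and $\langle f,g\rangle=\frac12\int_{\Omega_H}f(\mathbf t)\overline{g(\mathbf t)}\,d\mathbf t$. Let $\mathbb H_n^*=\{\mathbf k\in\mathbb H: -4n\le k_i-k_j\le 4n,\ 1\le i<j\le 4\}$. The dodecahedral Fourier partial sum is $S_nf(\mathbf t)=\sum_{\mathbf k\in\mathbb H_n^*}\langle f,\phi_{\mathbf k}\rangle\phi_{\mathbf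 k}(\mathbf t)$. *)

(* Defs.v *)
From HB Require Import structures.
From mathcomp Require Import all_boot all_order all_algebra.
From mathcomp Require Import all_classical all_reals all_analysis.
From mathcomp Require Import complex.

Set Implicit Arguments.
Unset Strict Implicit.
Unset Printing Implicit Defensive.

Import Order.TTheory GRing.Theory Num.Theory.
Import numFieldNormedType.Exports.

Local Open Scope classical_set_scope.
Local Open Scope ring_scope.
Local Open Scope complex_scope.

Section Dodecahedral.
Variable R : realType.

(* The hyperplane R^4_H = {t in R^4 : t1+t2+t3+t4 = 0} is parametrized  *)
(* by (t1,t2,t3) in R^3, with t4 := -(t1+t2+t3).                         *)
Definition pt := (R * R * R)%type.

Definition tH (x : pt) (i : 'I_4) : R :=
  match val i with
  | 0 => x.1.1
  | 1 => x.1.2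
  | 2 => x.2
  | _ => - (x.1.1 + x.1.2 + x.2)
  end.

(* Z^4_H = Z^4 cap R^4_H, parametrized by (k1,k2,k3) in Z^3, k4 := -(k1+k2+k3) *)
Definition ivec := (int * int * int)%type.

Definition kH (k : ivec) (i : 'I_4) : int :=
  match val i with
  | 0 => k.1.1
  | 1 => k.1.2
  | 2 => k.2
  | _ => - (k.1.1 + k.1.2 + k.2)
  end.

Definition dotH (k : ivec) (x : pt) : R :=
  \sum_(i < 4) (kH k i)%:~R * tH x i.

Definition shiftH (x : pt) (k : ivec) : pt :=
  (x.1.1 + (k.1.1)%:~R, x.1.2 + (k.1.2)%:~R, x.2 + (k.2)%:~R).

Definition Hperiodic (T : Type) (f : pt -> T) : Prop :=
  forall (x : pt) (k : ivec), f (shiftH x k) = f x.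

Definition OmegaH : set pt :=
  [set x | forall i j : 'I_4, (i < j)%N -> -1 < tH x i - tH x j <= 1].

Definition inHH (k : ivec) : bool :=
  [forall i : 'I_4, forall j : 'I_4, (4 %| kH k i - kH k j)%Z].

Definition inHstar (n : nat) (k : ivec) : bool :=
  inHH k &&
  [forall i : 'I_4, forall j : 'I_4,
     (i < j)%N ==> (`|kH k i - kH k j| <= (4 * n)%:Z)%R].

(* A finite box of Z^3 containing H_n^* (every k in H_n^* has |k_i| <= 3n,
   since k_i = (1/4) sum_j (k_i - k_j)); the sum below is filtered by inHstar. *)
Definition irange (n : nat) : seq int :=
  [seq (a%:Z - (4 * n)%:Z) | a <- iota 0 (8 * n).+1].
Definition ibox (n : nat) : seq ivec :=
  [seq (ab, c) | ab <- [seq (a, b) | a <- irange n, b <- irange n],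
                 c <- irange n].

Definition cexpi (th : R) : R[i] := cos th +i* sin th.
Definition conjc (z : R[i]) : R[i] := complex.Re z -i* complex.Im z.
Definition modc (z : R[i]) : R := Num.sqrt (complex.Re z ^+ 2 + complex.Im z ^+ 2).

Definition phiH (k : ivec) (x : pt) : R[i] := cexpi (pi / 2 * dotH k x).

Definition mu3 := ((@lebesgue_measure R \x @lebesgue_measure R)
                     \x @lebesgue_measure R)%E.

Definition cint (D : set pt) (g : pt -> R[i]) : R[i] :=
  Rintegral mu3 D (fun x => complex.Re (g x)) +i* Rintegral mu3 D (fun x => complex.Im (g x)).

(* integral w.r.t. the 3-dimensional Lebesgue measure dt of the hyperplane
   R^4_H: the parametrization (t1,t2,t3) |-> (t1,t2,t3,-(t1+t2+t3)) has
   Jacobian sqrt(det(I_3 + J_3)) = 2 (so that vol(Omega_H) = 2). *)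
Definition integralH (D : set pt) (g : pt -> R[i]) : R[i] := 2%:C * cint D g.

Definition innerH (f g : pt -> R[i]) : R[i] :=
  (1 / 2)%:C * integralH OmegaH (fun x => f x * conjc (g x)).

Definition Sn (n : nat) (f : pt -> R[i]) (x : pt) : R[i] :=
  \sum_(k <- ibox n | inHstar n k) innerH f (phiH k) * phiH k x.

End Dodecahedral.

(* Main.v *)
(* Writing m = ((k_i - k_4) / 4)_i identifies the lattice H with Z^3 and H_n^*
   with {m : |m_i|, |m_i - m_j| <= n}.  The points k of H_n^* are exactly the
   4 a - (a_1 + ... + a_4) (1,1,1,1) with a in {0, ..., n}^4 having a zero
   coordinate, so with A(u) = sum_(0 <= a <= n) e^(2 pi i a u) the Dirichlet
   kernel is
     D_n(t) = prod_i A(t_i) - prod_i (A(t_i) - 1),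
   which telescopes into four products, each omitting one coordinate t_i.
   Any three of the four coordinates parametrize the hyperplane, hence by
   Tonelli the L^1 norm of D_n is at most a constant times the cube of that of
   a one-dimensional kernel.  The latter is O(log n): |A(u)| is bounded by the
   sum over j <= J, 2^J > n, of 2^j times the indicator function of the points
   at distance at most 2^-j from Z, and each term has integral O(1). *)

Require Import Defs.
From HB Require Import structures.
From mathcomp Require Import all_boot all_order all_algebra.
From mathcomp Require Import all_classical all_reals all_analysis.
From mathcomp Require Import complex measurable_realfun ring lra zify.

Set Implicit Arguments.
Unset Strict Implicit.
Unset Printing Implicit Defensive.

Import Order.TTheory GRing.Theory Num.Theory.
Import numFieldNormedType.Exports.
Local Open Scope classical_set_scope.
Local Open Scope ring_scope.

(** * Geometric exponential sums and their dyadic majorant *)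

Section ExponentialSums.
Variable R : realType.
Implicit Types (z w : R[i]) (u v : R).

Lemma modcE z : modc z = Normc.normc z.
Proof. by case: z. Qed.

Lemma modc_ge0 z : 0 <= modc z.
Proof. exact: sqrtr_ge0. Qed.

Lemma modcM z w : modc (z * w) = modc z * modc w.
Proof. by rewrite !modcE Normc.normcM. Qed.

Lemma modcD z w : modc (z + w) <= modc z + modc w.
Proof. by rewrite !modcE; exact: le_normcD. Qed.

Lemma modcN z : modc (- z) = modc z.
Proof. by case: z => a b; rewrite /modc /= !sqrrN. Qed.

Lemma modc_cexpi u : modc (cexpi u) = 1.
Proof. by rewrite /modc /= cos2Dsin2 sqrtr1. Qed.

Lemma modc1 : modc (1 : R[i]) = 1.
Proof. by rewrite /modc /= expr1n expr0n addr0 sqrtr1. Qed.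

Lemma normr_Re_le z : `|complex.Re z| <= modc z.
Proof. by rewrite -sqrtr_sqr ler_sqrt ?addr_ge0 ?sqr_ge0 // lerDl sqr_ge0. Qed.

Lemma normr_Im_le z : `|complex.Im z| <= modc z.
Proof. by rewrite -sqrtr_sqr ler_sqrt ?addr_ge0 ?sqr_ge0 // lerDr sqr_ge0. Qed.

Lemma modc_le z : modc z <= `|complex.Re z| + `|complex.Im z|.
Proof.
rewrite -[leRHS]ger0_norm ?addr_ge0 // -sqrtr_sqr ler_sqrt ?sqr_ge0 //.
by rewrite sqrrD !real_normK ?num_real // lerD2r lerDl mulrn_wge0 // mulr_ge0.
Qed.

Lemma modc_sum (I : Type) (s : seq I) (F : I -> R[i]) :
  modc (\sum_(i <- s) F i) <= \sum_(i <- s) modc (F i).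
Proof.
elim/big_ind2 : _ => [|z a w b ha hb|//].
  by rewrite /modc /= expr0n addr0 sqrtr0.
by rewrite (le_trans (modcD _ _)) // lerD.
Qed.

Definition expi u : R[i] := cexpi (2 * pi * u).

Lemma cexpiD u v : cexpi (u + v) = cexpi u * cexpi v.
Proof.
by rewrite /cexpi cosD sinD; apply/eqP; rewrite eq_complex /= eqxx /= addrC.
Qed.

Lemma expiD u v : expi (u + v) = expi u * expi v.
Proof. by rewrite /expi mulrDr cexpiD. Qed.

Lemma expi0 : expi 0 = 1.
Proof. by rewrite /expi /cexpi mulr0 cos0 sin0. Qed.

Lemma modc_expi u : modc (expi u) = 1.
Proof. exact: modc_cexpi. Qed.

Lemma expi_nat (n : nat) : expi n%:R = 1.
Proof.
elim: n => [|n IHn]; first exact: expi0.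
rewrite -natr1 expiD IHn mul1r /expi /cexpi mulr1.
have -> : 2 * pi = pi *+ 2 :> R by rewrite mulr_natl.
by rewrite cos2pi sin2pi.
Qed.

Lemma expi_int (k : int) : expi k%:~R = 1.
Proof.
case: k => n; first exact: expi_nat.
have := expi_nat n.+1; rewrite NegzE mulrNz => h.
have := expiD (n.+1%:R) (- n.+1%:R); rewrite subrr expi0 h mul1r.
by move=> ->.
Qed.

(** The square of the modulus is [2 - 2 cos(2 pi v)], and the cosine is nonpositive in this range of
    [v]. *)
Lemma modc_expi_sub1_ge1 v : 1 / 4 <= `|v| <= 1 / 2 -> 1 <= modc (expi v - 1).
Proof.
move=> /andP[v1 v2].
rewrite -[leLHS]sqrtr1 ler_sqrt ?ler01 //; last by rewrite addr_ge0 ?sqr_ge0.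
rewrite /= subr0 sqrrB1.
have cv : cos (2 * pi * v) <= 0.
  rewrite -cos_norm normrM (ger0_norm (mulr_ge0 _ (pi_ge0 R))) //.
  have -> : 2 * pi * `|v| = (2 * pi * `|v| - pi / 2) + pi / 2 by rewrite subrK.
  rewrite cosDpihalf oppr_le0 sin_ge0_pi //.
  by have := pi_ge0 R => p0; apply/andP; split; nra.
have := cos2Dsin2 (2 * pi * v); rewrite mulr2n; lra.
Qed.

Lemma modc_expi_double v : modc (expi (2 * v) - 1) <= 2 * modc (expi v - 1).
Proof.
have -> : expi (2 * v) - 1 = (expi v + 1) * (expi v - 1).
  by rewrite (_ : 2 * v = v + v) ?expiD; ring.
rewrite modcM ler_wpM2r ?modc_ge0 // (le_trans (modcD _ _)) //.
by rewrite modc_expi modc1 -(natrD _ 1 1).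
Qed.

(* Doubling [v] until it lies in [1/4, 1/2] at most doubles the distance from
   [expi v] to [1] each time, which replaces a lower bound for the sine. *)
Lemma modc_expi_sub1_ge (j : nat) v :
  2 ^- j.+1 < `|v| <= 1 / 2 -> 2 <= 2 ^+ j * modc (expi v - 1).
Proof.
elim: j v => [|j IHj] v /andP[v1 v2].
  (* For [j = 0] the hypothesis reads [1/2 < |v| <= 1/2], which is absurd. *)
  by rewrite expr1 in v1; lra.
have [v4|v4] := leP (1 / 4) `|v|.
  have := @modc_expi_sub1_ge1 v; rewrite v4 v2 => /(_ isT) h.
  rewrite exprS -mulrA ler_peMr // mulr_ege1 // exprn_ege1 //; lra.
have := IHj (2 * v); rewrite normrM ger0_norm // => h.
rewrite exprSr -mulrA; apply: le_trans (h _) _.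
  apply/andP; split; last by lra.
  by rewrite exprS invfM in v1; rewrite -ltr_pdivrMl.
by rewrite ler_wpM2l ?exprn_ge0 // modc_expi_double.
Qed.

Definition geo (N : nat) u : R[i] := \sum_(a < N) expi (a%:R * u).

Lemma geoM N u : geo N u * (expi u - 1) = expi (N%:R * u) - 1.
Proof.
elim: N => [|N IHN]; first by rewrite /geo big_ord0 !mul0r expi0 subrr.
rewrite /geo big_ord_recr /= mulrDl IHN -natr1 mulrDl mul1r expiD.
by ring.
Qed.

(** Removing the term [a = 0] leaves a rotated shorter sum, so [A - 1] obeys the same bound as
    [A]. *)
Lemma geo_sub1 N u : geo N.+1 u - 1 = expi u * geo N u.
Proof.
rewrite /geo big_ord_recl mul0r expi0 addrC addKr mulr_sumr.
by apply: eq_bigr => a _; rewrite lift0 -expiD -natr1 mulrDl mul1r addrC.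
Qed.

Lemma modc_geo_le_size N u : modc (geo N u) <= N%:R.
Proof.
rewrite /geo; apply: le_trans (modc_sum _ _) _.
under eq_bigr do rewrite modc_expi.
by rewrite sumr_const card_ord.
Qed.

Definition near_int (j : nat) : set R :=
  [set u | exists k : int, `|u - k%:~R| <= 2 ^- j].

(** Up to a factor 2 this is [min(2^J, 1/dist(u, Z))]: the sum is dominated by its last nonzero
    term. As a sum of weighted indicators it can be integrated scale by scale. *)
Definition dyadic_kernel (J : nat) u : R :=
  \sum_(j < J.+1) 2 ^+ j * \1_(near_int j) u.

Lemma near_int0 u : near_int 0 u.
Proof.
exists (Num.floor u); rewrite expr0 invr1.
have /andP[h1 h2] := floor_itv u.
by rewrite intrD in h2; rewrite ger0_norm; lra.
Qed.

Lemma near_intN j u : near_int j (- u) = near_int j u.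
Proof.
apply/propext; split=> -[k hk]; exists (- k); rewrite mulrNz opprK.
  by rewrite -normrN opprD.
by rewrite -normrN opprD opprK.
Qed.

Lemma dyadic_kernelN J u : dyadic_kernel J (- u) = dyadic_kernel J u.
Proof.
apply: eq_bigr => j _; congr (_ * _); rewrite !indicE; congr ((nat_of_bool _)%:R).
by apply/idP/idP; rewrite !inE near_intN.
Qed.

Lemma dyadic_kernel_ge0 J u : 0 <= dyadic_kernel J u.
Proof. by apply: sumr_ge0 => j _; rewrite mulr_ge0 ?exprn_ge0. Qed.

Lemma dyadic_kernel_ge J j u : (j <= J)%N -> near_int j u ->
  2 ^+ j <= dyadic_kernel J u.
Proof.
move=> jJ uj; have jJ' : (j < J.+1)%N by [].
rewrite /dyadic_kernel (bigD1 (Ordinal jJ')) //= indicE mem_set // mulr1 lerDl.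
by apply: sumr_ge0 => i _; rewrite mulr_ge0 ?exprn_ge0.
Qed.

Lemma modc_expi_sub1_far j u : ~ near_int j.+1 u ->
  2 <= 2 ^+ j * modc (expi u - 1).
Proof.
move=> uj.
(* This is an integer nearest to [u]; by periodicity [u] may be replaced by [u - k], which lies in
   [-1/2, 1/2]. *)
pose k := Num.floor (u + 1 / 2).
have -> : expi u = expi (u - k%:~R).
  by rewrite -[in LHS](subrK k%:~R u) (expiD (u - k%:~R)) expi_int mulr1.
apply: modc_expi_sub1_ge; apply/andP; split.
  by rewrite ltNge; apply/negP => h; apply: uj; exists k.
have /andP[h1 h2] := floor_itv (u + 1 / 2).
by rewrite intrD -/k in h1 h2; rewrite ler_norml; lra.
Qed.

(** Within [2^-J] of an integer the trivial bound [N <= 2^J] suffices. Elsewhere let [j] be the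
    largest scale with [near_int j u]: then [|A(u)| |e(u) - 1| <= 2 <= 2^j |e(u) - 1|], where [e] is
    [expi], and the factor [|e(u) - 1|] cancels. *)
Lemma modc_geo_le N J u : (N <= 2 ^ J)%N -> modc (geo N u) <= dyadic_kernel J u.
Proof.
move=> NJ; have [uJ|] := pselect (near_int J u).
  apply: le_trans (modc_geo_le_size _ _) _.
  apply: le_trans (dyadic_kernel_ge (leqnn J) uJ).
  by rewrite -natrX ler_nat.
(* The scale of the neighbourhood is separated from the [J] of the kernel and lowered until [u] is
   in [near_int j] but not in [near_int j.+1]; the descent ends because [near_int 0] is the whole
   line. *)
have : (J <= J)%N by [].
move: {1 3}J => j; elim: j => [|j IHj] jJ uj; first by case: uj; exact: near_int0.
have [uj'|] := pselect (near_int j u); last by apply: IHj; exact: ltnW.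
apply: le_trans (dyadic_kernel_ge (ltnW jJ) uj').
have h2 := modc_expi_sub1_far uj.
have e0 : 0 < modc (expi u - 1).
  rewrite lt_def modc_ge0 andbT; apply: contraTneq h2 => ->.
  by rewrite mulr0 -ltNge.
rewrite -(ler_pM2r e0) -modcM geoM; apply: le_trans h2.
by rewrite (le_trans (modcD _ _)) // modcN modc1 modc_expi -(natrD _ 1 1).
Qed.

Lemma modc_geo_sub1_le N J u : (N.+1 <= 2 ^ J)%N ->
  modc (geo N.+1 u - 1) <= dyadic_kernel J u.
Proof.
by move=> NJ; rewrite geo_sub1 modcM modc_expi mul1r modc_geo_le // ltnW.
Qed.

End ExponentialSums.

(** * The Dirichlet kernel of H_n^* as a difference of two products *)

Section DirichletKernel.
Variable n : nat.
Implicit Types (k : ivec) (f g : {ffun 'I_4 -> 'I_n.+1}).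

Definition o1 : 'I_4 := lift ord0 ord0.
Definition o2 : 'I_4 := lift ord0 (lift ord0 ord0).
Definition o3 : 'I_4 := lift ord0 (lift ord0 (lift ord0 ord0)).

Lemma forall_I4 (P : 'I_4 -> Prop) :
  P ord0 -> P o1 -> P o2 -> P o3 -> forall i, P i.
Proof.
move=> p0 p1 p2 p3 [[|[|[|[|//]]]] h].
- by rewrite (_ : Ordinal h = ord0) //; exact: val_inj.
- by rewrite (_ : Ordinal h = o1) //; exact: val_inj.
- by rewrite (_ : Ordinal h = o2) //; exact: val_inj.
- by rewrite (_ : Ordinal h = o3) //; exact: val_inj.
Qed.

Lemma sum_I4 (V : nmodType) (F : 'I_4 -> V) :
  \sum_(i < 4) F i = F ord0 + F o1 + F o2 + F o3.
Proof. by rewrite !big_ord_recl big_ord0 addr0 !addrA. Qed.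

Lemma prod_I4 (V : pzSemiRingType) (F : 'I_4 -> V) :
  \prod_(i < 4) F i = F ord0 * F o1 * F o2 * F o3.
Proof. by rewrite !big_ord_recl big_ord0 mulr1 !mulrA. Qed.

(* [f |-> 4 f - (sum f) (1,1,1,1)] is a bijection from the grid points of
   [0, n]^4 having some coordinate [0] onto [H_n^*]. *)
Definition ivec_of f : ivec :=
  let c i : int := 4 * (f i)%:Z - \sum_(j < 4) (f j)%:Z in (c ord0, c o1, c o2).

Lemma kH_ivec_of f i :
  kH (ivec_of f) i = 4 * (f i)%:Z - \sum_(j < 4) (f j)%:Z.
Proof. by move: i; apply: forall_I4; rewrite /kH /= ?sum_I4 //; lia. Qed.

Lemma mem_irange (z : int) : (z \in irange n) = (- (4 * n)%:Z <= z <= (4 * n)%:Z).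
Proof.
apply/mapP/idP => [[a]|h].
  by rewrite mem_iota => ? ->; lia.
exists (absz (z + (4 * n)%:Z)); last by lia.
by rewrite mem_iota; lia.
Qed.

Lemma mem_ibox k : (k \in ibox n) =
  [&& k.1.1 \in irange n, k.1.2 \in irange n & k.2 \in irange n].
Proof.
case: k => [[a b] c]; rewrite /ibox; move: (irange n) => s; rewrite /= andbA.
apply/allpairsP/idP => [[[ab c'] /= [/allpairsP[[a' b'] /= [ha hb ->]] hc [-> -> ->]]]|].
  by rewrite ha hb hc.
move=> /andP[/andP[ha hb] hc]; exists ((a, b), c); split=> //.
by apply/allpairsP; exists (a, b).
Qed.

Lemma ibox_uniq : uniq (ibox n).
Proof.
have u : uniq (irange n).
  by rewrite map_inj_uniq ?iota_uniq // => a b /addIr[].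
apply: allpairs_uniq => //; last by move=> [? ?] [? ?].
by apply: allpairs_uniq => // -[? ?] [? ?].
Qed.

(** Equal images force [4 (f_i - g_i)] to be the same number [sum f - sum g] for all [i]. A zero of
    [f] makes it nonpositive and a zero of [g] makes it nonnegative. *)
Lemma ivec_of_inj f g : [exists i, f i == ord0] -> [exists i, g i == ord0] ->
  ivec_of f = ivec_of g -> f = g.
Proof.
move=> /existsP[i /eqP fi] /existsP[j /eqP gj] fg; apply/ffunP => l.
have h p := etrans (esym (kH_ivec_of f p)) (etrans (congr1 (kH^~ p) fg) (kH_ivec_of g p)).
have hi := h i; have hj := h j; have hl := h l.
by apply: val_inj; move: hi hj hl; rewrite fi gj /=; lia.
Qed.

Lemma ivec_of_inHstar f : (ivec_of f \in ibox n) && inHstar n (ivec_of f).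
Proof.
have fn i : (f i <= n)%N by rewrite -ltnS ltn_ord.
have := fn ord0; have := fn o1; have := fn o2; have := fn o3 => f3 f2 f1 f0.
apply/andP; split.
  by rewrite mem_ibox !mem_irange /= sum_I4; apply/and3P; split; lia.
apply/andP; split.
  apply/forallP => i; apply/forallP => j; rewrite !kH_ivec_of.
  by apply/dvdzP; exists ((f i)%:Z - (f j)%:Z); lia.
apply/forallP => i; apply/forallP => j; apply/implyP => _; rewrite !kH_ivec_of.
by have := fn i; have := fn j; lia.
Qed.

(** Subtract the smallest coordinate and divide by 4: the congruences make the quotients integers,
    the bounds on differences place them in [0, n], and the smallest coordinate becomes 0. Since [k]
    sums to 0, the sum of these quotients is minus the smallest coordinate, so [ivec_of] gives back
    [k]. *)
Lemma inHstar_ivec_of k : inHstar n k ->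
  exists2 f : {ffun 'I_4 -> 'I_n.+1}, [exists i, f i == ord0] & k = ivec_of f.
Proof.
move=> /andP[/forallP k4 /forallP kn].
have [i0 _ imin] := @arg_minP _ _ _ (ord0 : 'I_4) xpredT (kH k) isT.
have kn' i : kH k i - kH k i0 <= (4 * n)%:Z.
  have := imin i isT; have [ii|ii|/val_inj ->] := ltngtP i i0; last by lia.
    by have /forallP/(_ i0)/implyP/(_ ii) := kn i; lia.
  by have /forallP/(_ i)/implyP/(_ ii) := kn i0; lia.
pose f : {ffun 'I_4 -> 'I_n.+1} :=
  [ffun i => inord `|((kH k i - kH k i0) %/ 4)%Z|].
have fE i : kH k i - kH k i0 = 4 * (f i)%:Z.
  have /forallP/(_ i0)/dvdzP[q kq] := k4 i.
  have := imin i isT; have := kn' i; rewrite ffunE kq mulzK //= => h1 h2.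
  by rewrite inordK; lia.
exists f.
  by apply/existsP; exists i0; apply/eqP/val_inj => /=; have := fE i0; lia.
have := fE ord0; have := fE o1; have := fE o2; have := fE o3.
rewrite /ivec_of sum_I4; move: (kH k i0) => m.
case: k {k4 kn imin kn' fE} @f => [[a b] c] f; rewrite /kH /= => *.
by congr (_, _, _); lia.
Qed.

Variable R : realType.
Implicit Types x : pt R.

Lemma sum_tH x : \sum_(i < 4) tH x i = 0.
Proof. by rewrite sum_I4 /tH /= addrN. Qed.

(** The multiple of (1,1,1,1) in [ivec_of f] is orthogonal to the hyperplane, and the factor 4 turns
    [pi / 2] into [2 pi]. *)
Lemma phiH_ivec_of f x :
  phiH (ivec_of f) x = \prod_(i < 4) expi ((f i)%:R * tH x i).
Proof.
rewrite prod_I4 -!expiD /phiH /expi; congr cexpi.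
rewrite /dotH; under eq_bigr do rewrite kH_ivec_of rmorphB rmorphM mulrBl /=.
rewrite big_split /= sumrN -mulr_sumr sum_tH mulr0 subr0 sum_I4 /=.
by field.
Qed.

(** The grid points with some zero coordinate are all grid points minus those with none; the sum
    over either of these two sets factors over the coordinates. *)
Lemma sum_phiH x :
  \sum_(k <- ibox n | inHstar n k) phiH k x =
  \prod_(i < 4) geo n.+1 (tH x i) - \prod_(i < 4) (geo n.+1 (tH x i) - 1).
Proof.
pose F (i : 'I_4) (a : 'I_n.+1) := expi (a%:R * tH x i).
pose A := [pred f : {ffun 'I_4 -> 'I_n.+1} | [exists i, f i == ord0]].
have -> : \sum_(k <- ibox n | inHstar n k) phiH k x =
          \sum_(f | A f) \prod_i F i (f i).
  under [RHS]eq_bigr do rewrite -phiH_ivec_of.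
  rewrite -[LHS]big_filter -[RHS]big_filter.
  rewrite -(big_map ivec_of xpredT (fun k => phiH k x)).
  apply/perm_big/uniq_perm.
  - by rewrite filter_uniq // ibox_uniq.
  - rewrite map_inj_in_uniq ?filter_uniq ?index_enum_uniq // => f g.
    by rewrite !mem_filter => /andP[? _] /andP[? _]; exact: ivec_of_inj.
  move=> k; rewrite mem_filter; apply/idP/mapP => [/andP[/inHstar_ivec_of[f Af ->] _]|].
    by exists f => //; rewrite mem_filter mem_index_enum andbT.
  by move=> [f _ ->]; have /andP[-> ->] := ivec_of_inHstar f.
have -> : \prod_(i < 4) geo n.+1 (tH x i) =
    \sum_(f : {ffun 'I_4 -> 'I_n.+1}) \prod_i F i (f i).
  exact: bigA_distr_bigA.
rewrite [X in _ = X - _](bigID A) /=; apply/eqP; rewrite eq_sym subr_eq.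
apply/eqP; congr (_ + _).
(* Keeping the index [a = 0] with value 0 lets both products expand over the same grid; exactly the
   points having a zero coordinate then vanish. *)
have geoE i : geo n.+1 (tH x i) - 1 = \sum_a (if a == ord0 then 0 else F i a).
  rewrite /geo big_ord_recl mul0r expi0 addrC addKr.
  by rewrite [RHS]big_ord_recl eqxx add0r.
under [RHS]eq_bigr do rewrite geoE.
rewrite bigA_distr_bigA big_mkcond /=; apply: eq_bigr => f _.
have [/existsP[i fi]|/existsPn h] := boolP [exists i, f i == ord0].
  by rewrite [RHS](bigD1 i) //= fi mul0r.
by apply: eq_bigr => i _; rewrite (negbTE (h i)).
Qed.

Lemma modc_sum_phiH (J : nat) x : (n.+1 <= 2 ^ J)%N ->
  modc (\sum_(k <- ibox n | inHstar n k) phiH k x) <=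
  \sum_(i < 4) \prod_(j < 4 | j != i) dyadic_kernel J (tH x j).
Proof.
move=> nJ; rewrite sum_phiH.
have g j : modc (geo n.+1 (tH x j)) <= dyadic_kernel J (tH x j) := modc_geo_le _ nJ.
have g' j : modc (geo n.+1 (tH x j) - 1) <= dyadic_kernel J (tH x j) :=
  modc_geo_sub1_le _ nJ.
have dE i : \prod_(j < 4 | j != i) dyadic_kernel J (tH x j) =
    \prod_(j < 4) (if j != i then dyadic_kernel J (tH x j) else 1).
  by rewrite big_mkcond.
rewrite sum_I4 !dE !prod_I4 /= !(mulr1, mul1r).
(* Replacing one factor [A] by [A - 1] changes a product by the product of the other three factors;
   doing so for the four coordinates in turn telescopes. *)
have -> (a b c d : R[i]) : a * b * c * d - (a - 1) * (b - 1) * (c - 1) * (d - 1)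
    = b * c * d + (a - 1) * c * d + (a - 1) * (b - 1) * d
      + (a - 1) * (b - 1) * (c - 1) by ring.
have mul3 (u v w : R[i]) (a b c : R) : modc u <= a -> modc v <= b ->
    modc w <= c -> modc (u * v * w) <= a * b * c.
  by move=> *; rewrite !modcM !ler_pM ?mulr_ge0 ?modc_ge0.
by do 3 (apply: (le_trans (modcD _ _)); apply: lerD; last exact: mul3);
  exact: mul3.
Qed.

End DirichletKernel.

(** * Continuous functions are measurable for the product sigma-algebra on R^3 *)

Section ProductMeasurability.
Variable R : realType.

(** An open set is the countable union of the boxes with rational centre and radius [1/(m+1)] that
    it contains. *)
Lemma open_measurable3 (U : set (pt R)) : open U -> measurable U.
Proof.
move=> oU.
pose box (p : rat * rat * rat * nat) : set (pt R) :=
  let: (a, b, c, m) := p in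
  (ball (ratr a : R) m.+1%:R^-1 `*` ball (ratr b : R) m.+1%:R^-1)
    `*` ball (ratr c : R) m.+1%:R^-1.
have -> : U = \bigcup_p (if `[< box p `<=` U >] then box p else set0).
  apply/seteqP; split => [x Ux|x [p _]]; last by case: asboolP => // h /h.
  have /nbhs_ballP[e /= e0 xU] := open_nbhs_nbhs (conj oU Ux).
  (* The centre will be within one radius of [x], so the points of the box are within two radii of
     [x]. *)
  have [m me] : exists m, 2 * (m.+1%:R^-1 : R) < e.
    have [m _ /(_ m (leqnn m)) /= hm] :=
      near_infty_natSinv_lt (PosNum (divr_gt0 e0 (ltr0Sn R 1))).
    by exists m; rewrite -ltr_pdivlMl // mulrC.
  have m0 : 0 < m.+1%:R^-1 :> R by rewrite invr_gt0.
  have near_rat (y : R) : exists q : rat, `|ratr q - y| < m.+1%:R^-1.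
    have [|q] := @rat_in_itvoo R y (y + m.+1%:R^-1); first by rewrite ltrDl.
    by rewrite in_itv /= => /andP[h1 h2]; exists q;
      rewrite gtr0_norm ?subr_gt0 // ltrBlDl.
  have [a ha] := near_rat x.1.1; have [b hb] := near_rat x.1.2.
  have [c hc] := near_rat x.2.
  have near_ball (q : rat) (y z : R) : `|ratr q - y| < m.+1%:R^-1 ->
      ball (ratr q : R) m.+1%:R^-1 z -> ball y e z.
    rewrite /ball /= => h1 h2; apply: lt_trans me.
    have -> : y - z = - (ratr q - y) + (ratr q - z) by ring.
    by rewrite (le_lt_trans (ler_normD _ _)) // normrN mulr_natl mulr2n ltrD.
  exists (a, b, c, m) => //; case: asboolP => [_|[]]; first by split; [split|].
  move=> y [[ya yb] yc]; apply: xU; split; first split.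
  - exact: near_ball ya.
  - exact: near_ball yb.
  - exact: near_ball yc.
apply: countable_bigcupT_measurable; first exact: countableP.
move=> [[[a b] c] m]; case: asboolP => // _.
by do 2? apply: measurableX => //; exact: measurable_ball.
Qed.

Lemma continuous_measurable3 (f : pt R -> R) :
  continuous f -> measurable_fun setT f.
Proof.
move=> /continuousP cf; apply: (measurability _ (RGenOpens.measurableE R)).
move=> _ [_ [a [b ->] <-]]; rewrite setTI; apply: open_measurable3.
exact/cf/interval_open.
Qed.

End ProductMeasurability.

(** * Iterated integral bounds for products of kernels *)

Section Tonelli.
Context d1 d2 (T1 : measurableType d1) (T2 : measurableType d2) (R : realType).
Variable m1 : {sigma_finite_measure set T1 -> \bar R}.
Variable m2 : {sigma_finite_measure set T2 -> \bar R}.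
Variables (b : T1 * T2 -> R) (A B : R).
Hypotheses (b0 : forall z, 0 <= b z) (mb : measurable_fun setT b).

Lemma tonelli_le1 (a : T1 -> R) : (forall x, 0 <= a x) ->
  measurable_fun setT a -> 0 <= B ->
  (\int[m1]_x (a x)%:E <= A%:E)%E ->
  (forall x, \int[m2]_y (b (x, y))%:E <= B%:E)%E ->
  (\int[m1 \x m2]_z (a z.1 * b z)%:E <= (A * B)%:E)%E.
Proof.
move=> a0 ma B0 aA bB.
have mab : measurable_fun setT (fun z => (a z.1 * b z)%:E).
  by apply/measurable_EFinP/measurable_funM => //; exact: measurableT_comp.
rewrite (fubini_tonelli1 _ mab); last by move=> z; rewrite lee_fin mulr_ge0.
apply: (@le_trans _ _ (\int[m1]_x ((a x)%:E * B%:E))%E).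
  apply: ge0_le_integral => //.
  - by move=> x _; apply: integral_ge0 => y _; rewrite lee_fin mulr_ge0.
  - by apply: (measurable_fun_fubini_tonelli_F _ mab) => z; rewrite lee_fin mulr_ge0.
  - by apply: emeasurable_funM => //; exact/measurable_EFinP.
  move=> x _; rewrite /fubini_F.
  under eq_integral do rewrite EFinM /=.
  rewrite ge0_integralZl_EFin //.
  - by rewrite lee_wpmul2l // lee_fin.
  - by move=> y _; rewrite lee_fin.
  - by apply/measurable_EFinP; apply: measurableT_comp.
rewrite ge0_integralZr //.
- by rewrite EFinM lee_wpmul2r.
- exact/measurable_EFinP.
- by move=> x _; rewrite lee_fin.
Qed.

(** The mirror image, with the first variable innermost; it serves when the omitted coordinate is
    [t_1] or [t_2]. *)
Lemma tonelli_le2 (a : T2 -> R) : (forall x, 0 <= a x) ->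
  measurable_fun setT a -> 0 <= B ->
  (\int[m2]_y (a y)%:E <= A%:E)%E ->
  (forall y, \int[m1]_x (b (x, y))%:E <= B%:E)%E ->
  (\int[m1 \x m2]_z (a z.2 * b z)%:E <= (A * B)%:E)%E.
Proof.
move=> a0 ma B0 aA bB.
have mab : measurable_fun setT (fun z => (a z.2 * b z)%:E).
  by apply/measurable_EFinP/measurable_funM => //; exact: measurableT_comp.
rewrite (fubini_tonelli2 _ mab); last by move=> z; rewrite lee_fin mulr_ge0.
apply: (@le_trans _ _ (\int[m2]_y ((a y)%:E * B%:E))%E).
  apply: ge0_le_integral => //.
  - by move=> y _; apply: integral_ge0 => x _; rewrite lee_fin mulr_ge0.
  - by apply: (measurable_fun_fubini_tonelli_G _ mab) => z; rewrite lee_fin mulr_ge0.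
  - by apply: emeasurable_funM => //; exact/measurable_EFinP.
  move=> y _; rewrite /fubini_G.
  under eq_integral do rewrite EFinM /=.
  rewrite ge0_integralZl_EFin //.
  - by rewrite lee_wpmul2l // lee_fin.
  - by move=> x _; rewrite lee_fin.
  - by apply/measurable_EFinP; apply: measurableT_comp.
rewrite ge0_integralZr //.
- by rewrite EFinM lee_wpmul2r.
- exact/measurable_EFinP.
- by move=> x _; rewrite lee_fin.
Qed.

End Tonelli.

(** * Integrals of truncated kernels in one, two and three variables *)

Section KernelIntegral.
Variable R : realType.
Local Notation leb := (@lebesgue_measure R).
Local Notation mR := (measurableTypeR R).

(* The library instance making a product of sigma-finite measures sigma-finite
   is not found by unification, being shadowed by that of subprobabilities. *)
Definition leb2 : set (mR * mR) -> \bar R := (leb \x leb)%E.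

HB.instance Definition _ := Measure.on leb2.

Lemma leb2_sigma_finite : sigma_finite setT leb2.
Proof.
pose I (n : nat) : set mR := `[- n%:R, n%:R]%classic.
have mI n : measurable (I n) by exact: measurable_itv.
have in_I (x : R) n : (Num.trunc `|x| < n)%N -> I n x.
  move=> xn; rewrite /I /= in_itv /= -ler_norml.
  have /andP[_ /ltW/le_trans->] // := truncn_itv (normr_ge0 x).
  by rewrite ler_nat.
exists (fun n => I n `*` I n).
  apply/seteqP; split => // -[x y] _.
  exists (maxn (Num.trunc `|x|) (Num.trunc `|y|)).+1 => //; split; apply: in_I => /=;
    by rewrite ltnS ?leq_maxl ?leq_maxr.
move=> n; split; first exact: measurableX.
have Ioo : (leb (I n) < +oo)%E.
  by rewrite /I lebesgue_measure_itv; case: ifP => // _; rewrite -EFinB ltry.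
rewrite [X in (X < _)%E]product_measure1E //.
by apply: lte_mul_pinfty; rewrite ?ge0_fin_numE.
Qed.

HB.instance Definition _ := Measure_isSigmaFinite.Build _ _ _ leb2 leb2_sigma_finite.

Lemma measurable_near_int j : measurable (@near_int R j).
Proof.
have -> : @near_int R j =
    \bigcup_(k : int) `[k%:~R - 2 ^- j, k%:~R + 2 ^- j]%classic.
  apply/seteqP; split => [u [k uk]|u [k _ /=]].
    by exists k => //=; rewrite in_itv /= -ler_distl.
  by rewrite in_itv /= => uk; exists k; rewrite ler_distl.
by apply: countable_bigcupT_measurable => //; exact: countableP.
Qed.

Lemma measurable_dyadic_kernel J : measurable_fun setT (@dyadic_kernel R J).
Proof.
apply: measurable_sum => j; apply: measurable_funM => //.
by apply: measurable_indic; exact: measurable_near_int.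
Qed.

(** The cutoff makes the periodic kernel integrable on the line while changing nothing on [OmegaH].
    The shift [s] is arbitrary because it will depend on other integration variables. *)
Definition box_kernel J (s x : R) : R :=
  \1_(`[-1, 1]%classic) x * dyadic_kernel J (s - x).

Lemma box_kernel_ge0 J s x : 0 <= box_kernel J s x.
Proof. by rewrite mulr_ge0 ?dyadic_kernel_ge0. Qed.

Lemma box_kernel_in J s x : -1 <= x <= 1 ->
  box_kernel J s x = dyadic_kernel J (s - x).
Proof. by move=> x1; rewrite /box_kernel indicE mem_set ?mul1r //= in_itv. Qed.

Lemma measurable_box_kernel d (T : measurableType d) J (s x : T -> R) :
  measurable_fun setT s -> measurable_fun setT x ->
  measurable_fun setT (fun z => box_kernel J (s z) (x z)).
Proof.
move=> ms mx; apply: measurable_funM.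
  by apply: measurableT_comp mx; exact: measurable_indic.
by apply: measurableT_comp; [exact: measurable_dyadic_kernel | exact: measurable_funB].
Qed.

Definition box_near_int j (s : R) : set R :=
  `[-1, 1]%classic `&` [set x | near_int j (s - x)].

Lemma measurable_box_near_int j s : measurable (box_near_int j s).
Proof.
apply: measurableI => //.
have ms : measurable_fun setT (fun x : R => s - x) by exact: measurable_funB.
by rewrite -[X in measurable X]setTI; apply: ms => //; exact: measurable_near_int.
Qed.

(** If [|x| <= 1] and [s - x] is within [2^-j <= 1] of an integer [m], then [m] is one of the five
    integers from [floor s - 2] to [floor s + 2]. Each contributes an interval of length
    [2 * 2^-j]. *)
Lemma lebesgue_box_near_int_le j s :
  (leb (box_near_int j s) <= (10 * 2 ^- j)%:E)%E.
Proof.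
have d0 : 0 < 2 ^- j :> R by rewrite invr_gt0 exprn_gt0.
have d1 : 2 ^- j <= 1 :> R by rewrite invf_le1 ?exprn_gt0 // exprn_ege1 // ler1n.
pose k (i : nat) : R := (Num.floor s - 2 + i%:Z)%:~R.
pose F i : set R := `[s - k i - 2 ^- j, s - k i + 2 ^- j]%classic.
have mF i : measurable (F i) by exact: measurable_itv.
apply: (@le_trans _ _ (\sum_(i < 5) leb (F i))%E).
  apply: (content_subadditive leb (fun i _ => mF i) (measurable_box_near_int _ _)).
  rewrite -bigcup_mkord => x [/=]; rewrite in_itv /= => /andP[x1 x2] [m].
  rewrite ler_norml => /andP[m1 m2].
  have /andP[s1 s2] := floor_itv s.
  rewrite intrD /= in s2.
  have mlo : Num.floor s - 2 <= m by rewrite -(@ler_int R) intrB; lra.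
  have mhi : m < Num.floor s + 3 by rewrite -(@ltr_int R) intrD; lra.
  exists (absz (m - (Num.floor s - 2))%R); first by rewrite /=; lia.
  have km : k (absz (m - (Num.floor s - 2))%R) = m%:~R.
    by rewrite /k; congr (_%:~R); lia.
  by rewrite /F /= in_itv /= km; apply/andP; split; lra.
have le5 i : leb (F i) = (2 * 2 ^- j)%:E.
  rewrite lebesgue_measure_itv /= lte_fin ifT; last by lra.
  by rewrite -EFinD; congr EFin; ring.
under eq_bigr do rewrite le5.
by rewrite sumEFin lee_fin sumr_const card_ord -mulr_natl; lra.
Qed.

(** The weight [2^j] cancels the measure [10 * 2^-j], so each of the [J + 1] scales contributes at
    most 10. *)
Lemma integral_box_kernel_le J s :
  (\int[leb]_x (box_kernel J s x)%:E <= (10 * J.+1%:R)%:E)%E.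
Proof.
have -> : (fun x => (box_kernel J s x)%:E) = (fun x =>
    \sum_(j < J.+1) ((2 ^+ j)%:E * (\1_(box_near_int j s) x)%:E)%E).
  apply/funext => x; rewrite /box_kernel /dyadic_kernel mulr_sumr -sumEFin.
  apply: eq_bigr => j _; rewrite -EFinM; congr EFin.
  rewrite mulrCA indicI /=; congr (_ * (_ * _)).
have mI j : measurable_fun setT (fun x => (\1_(box_near_int j s) x : R)%:E).
  by apply/measurable_EFinP; apply: measurable_indic; exact: measurable_box_near_int.
rewrite (ge0_integral_sum leb measurableT
    (fun j => emeasurable_funM (measurable_cst _) (mI (j : 'I_J.+1)))); last first.
  by move=> j x _; rewrite -EFinM lee_fin mulr_ge0 ?exprn_ge0.
apply: (@le_trans _ _ (\sum_(j < J.+1) (10%:R)%:E)%E); last first.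
  by rewrite sumEFin lee_fin sumr_const card_ord mulr_natr.
apply: lee_sum => j _.
rewrite ge0_integralZl_EFin ?exprn_ge0 //; last exact: mI.
rewrite integral_indic ?setIT //; last exact: measurable_box_near_int.
apply: le_trans (lee_wpmul2l _ (lebesgue_box_near_int_le j s)) _.
  by rewrite lee_fin exprn_ge0.
by rewrite -EFinM lee_fin mulrCA divff ?mulr1 // expf_neq0.
Qed.

Variable J : nat.
Local Notation L := (10 * J.+1%:R : R).
Local Notation h := (box_kernel J).

Let L0 : 0 <= L. Proof. by rewrite mulr_ge0. Qed.

Let mh1 (a : R) : measurable_fun setT (h a).
Proof. exact: measurable_box_kernel. Qed.

(** The digits here and in the names below list the variables from the outermost integral to the
    innermost. The shift [c] of the innermost kernel may depend on the outer variables, which is how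
    the fourth coordinate enters. *)
Lemma integral_box_kernel2_le12 (a : R) (c : R -> R) : measurable_fun setT c ->
  (\int[(leb \x leb)%E]_z (h a z.1 * h (c z.1) z.2)%:E <= (L * L)%:E)%E.
Proof.
move=> mc; apply: (@tonelli_le1 _ _ _ _ _ leb leb (fun z => h (c z.1) z.2)) => //.
- by move=> z; exact: box_kernel_ge0.
- by apply: measurable_box_kernel => //; exact: measurableT_comp.
- by move=> x; exact: box_kernel_ge0.
- exact: mh1.
- exact: integral_box_kernel_le.
- by move=> x /=; exact: integral_box_kernel_le.
Qed.

Lemma integral_box_kernel2_le21 (a : R) (c : R -> R) : measurable_fun setT c ->
  (\int[(leb \x leb)%E]_z (h a z.2 * h (c z.2) z.1)%:E <= (L * L)%:E)%E.
Proof.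
move=> mc; apply: (@tonelli_le2 _ _ _ _ _ leb leb (fun z => h (c z.2) z.1)) => //.
- by move=> z; exact: box_kernel_ge0.
- by apply: measurable_box_kernel => //; exact: measurableT_comp.
- by move=> x; exact: box_kernel_ge0.
- exact: mh1.
- exact: integral_box_kernel_le.
- by move=> x /=; exact: integral_box_kernel_le.
Qed.

Lemma integral_box_kernel3_le123 (a b : R) (c : R * R -> R) :
  measurable_fun setT c ->
  (\int[@mu3 R]_z (h a z.1.1 * h b z.1.2 * h (c z.1) z.2)%:E <= (L * L * L)%:E)%E.
Proof.
move=> mc; rewrite /mu3.
refine (@tonelli_le1 _ _ _ _ R leb2 leb (fun z => h (c z.1) z.2)
  (L * L) L _ _ (fun z => h a z.1 * h b z.2) _ _ L0 _ _).
- by move=> z; exact: box_kernel_ge0.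
- by apply: measurable_box_kernel => //; exact: measurableT_comp.
- by move=> x; rewrite mulr_ge0 ?box_kernel_ge0.
- by apply: measurable_funM; apply: measurable_box_kernel.
- exact: integral_box_kernel2_le12.
- by move=> x /=; exact: integral_box_kernel_le.
Qed.

(** The measure [mu3] groups the first two variables, so when the innermost variable is one of them
    the third is taken outermost. *)
Lemma integral_box_kernel3_le312 (a b : R) (c : R * R -> R) :
  measurable_fun setT c ->
  (\int[@mu3 R]_z (h a z.2 * (h b z.1.1 * h (c (z.1.1, z.2)) z.1.2))%:E
    <= (L * (L * L))%:E)%E.
Proof.
move=> mc; rewrite /mu3.
refine (@tonelli_le2 _ _ _ _ R leb2 leb
  (fun z => h b z.1.1 * h (c (z.1.1, z.2)) z.1.2) L (L * L) _ _ (h a) _ _ _ _ _).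
- by move=> z; rewrite mulr_ge0 ?box_kernel_ge0.
- apply: measurable_funM.
    by apply: measurable_box_kernel => //; exact: measurableT_comp.
  apply: measurable_box_kernel; last exact: measurableT_comp.
  apply: measurableT_comp => //; apply: measurable_fun_pair => //.
  exact: measurableT_comp.
- by move=> x; exact: box_kernel_ge0.
- exact: mh1.
- by rewrite mulr_ge0.
- exact: integral_box_kernel_le.
move=> y; apply: (@integral_box_kernel2_le12 b (fun x => c (x, y))).
by apply: measurableT_comp => //; exact: measurable_fun_pair.
Qed.

Lemma integral_box_kernel3_le321 (a b : R) (c : R * R -> R) :
  measurable_fun setT c ->
  (\int[@mu3 R]_z (h a z.2 * (h b z.1.2 * h (c (z.1.2, z.2)) z.1.1))%:E
    <= (L * (L * L))%:E)%E.
Proof.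
move=> mc; rewrite /mu3.
refine (@tonelli_le2 _ _ _ _ R leb2 leb
  (fun z => h b z.1.2 * h (c (z.1.2, z.2)) z.1.1) L (L * L) _ _ (h a) _ _ _ _ _).
- by move=> z; rewrite mulr_ge0 ?box_kernel_ge0.
- apply: measurable_funM.
    by apply: measurable_box_kernel => //; exact: measurableT_comp.
  apply: measurable_box_kernel; last exact: measurableT_comp.
  apply: measurableT_comp => //; apply: measurable_fun_pair => //.
  exact: measurableT_comp.
- by move=> x; exact: box_kernel_ge0.
- exact: mh1.
- by rewrite mulr_ge0.
- exact: integral_box_kernel_le.
move=> y; apply: (@integral_box_kernel2_le21 b (fun x => c (x, y))).
by apply: measurableT_comp => //; exact: measurable_fun_pair.
Qed.

End KernelIntegral.

(** * The integral of the kernel majorant over the dodecahedron *)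

Section OmegaIntegral.
Variable R : realType.
Implicit Types (t x : pt R) (i j : 'I_4).

Lemma measurable_tH j : measurable_fun setT (fun x : pt R => tH x j).
Proof.
have m1 : measurable_fun setT (fun x : pt R => x.1.1) by exact: measurableT_comp.
have m2 : measurable_fun setT (fun x : pt R => x.1.2) by exact: measurableT_comp.
have m3 : measurable_fun setT (fun x : pt R => x.2) by exact: measurable_snd.
move: j; apply: forall_I4; [exact: m1 | exact: m2 | exact: m3 | rewrite /tH /=].
under eq_fun do rewrite -sub0r.
apply: measurable_funB => //.
by do 2? apply: measurable_funD.
Qed.

Lemma tHB t x j : tH (t - x) j = tH t j - tH x j.
Proof. by move: j; apply: forall_I4; rewrite /tH //=; ring. Qed.

(** Each coordinate is the mean of its four differences with all coordinates, one of them zero, so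
    even 3/4 bounds it. *)
Lemma OmegaH_le1 x j : OmegaH x -> -1 <= tH x j <= 1.
Proof.
move=> xO; have := xO ord0 o1 isT; have := xO ord0 o2 isT.
have := xO ord0 o3 isT; have := xO o1 o2 isT; have := xO o1 o3 isT.
have := xO o2 o3 isT; rewrite /tH /= => *.
by move: j; apply: forall_I4 => /=; lra.
Qed.

Lemma measurable_OmegaH : measurable (@OmegaH R).
Proof.
have -> : @OmegaH R = \bigcap_(p in [set p : 'I_4 * 'I_4 | (p.1 < p.2)%N])
    [set x : pt R | (tH x p.1 - tH x p.2) \in `]-1, 1]].
  apply/seteqP; split => [x xO [i j] /= /(xO i j)|x xO i j ij]; first by rewrite in_itv.
  by have := xO (i, j) ij; rewrite /= in_itv.
apply: fin_bigcap_measurable => [|[i j] _ /=]; first exact: finite_finset.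
have mB : measurable_fun setT (fun x : pt R => tH x i - tH x j).
  by apply: measurable_funB; exact: measurable_tH.
by rewrite -[X in measurable X]setTI; exact: (mB measurableT _ (measurable_itv `]-1, 1])).
Qed.

Lemma mu3_OmegaH_lty : (@mu3 R (@OmegaH R) < +oo)%E.
Proof.
pose I : set (measurableTypeR R) := `[-1, 1]%classic.
have mI : measurable I by exact: measurable_itv.
apply: (@le_lt_trans _ _ (@mu3 R ((I `*` I) `*` I))).
  apply: le_measure; rewrite ?inE.
  - exact: measurable_OmegaH.
  - by do 2? apply: measurableX.
  move=> x xO; split; first split; rewrite /I /= in_itv.
  - exact: (OmegaH_le1 ord0 xO).
  - exact: (OmegaH_le1 o1 xO).
  - exact: (OmegaH_le1 o2 xO).
have -> : @mu3 R ((I `*` I) `*` I) = (@leb2 R (I `*` I) * @lebesgue_measure R I)%E.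
  by apply: (product_measure1E (@leb2 R) (@lebesgue_measure R)) => //; exact: measurableX.
have -> : @leb2 R (I `*` I) = (@lebesgue_measure R I * @lebesgue_measure R I)%E.
  exact: product_measure1E.
rewrite /I lebesgue_measure_itv /= lte_fin.
by case: ifP => _; rewrite ?mul0e // -!EFinD -!EFinM ltry.
Qed.

Definition kernel_majorant J (u : pt R) : R :=
  \sum_(i < 4) \prod_(j < 4 | j != i) dyadic_kernel J (tH u j).

Lemma kernel_majorant_ge0 J u : 0 <= kernel_majorant J u.
Proof.
by apply: sumr_ge0 => i _; apply: prodr_ge0 => j _; exact: dyadic_kernel_ge0.
Qed.

Lemma measurable_prod_dyadic_kernel J t i :
  measurable_fun setT (fun x => \prod_(j < 4 | j != i) dyadic_kernel J (tH (t - x) j)).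
Proof.
have -> : (fun x => \prod_(j < 4 | j != i) dyadic_kernel J (tH (t - x) j)) =
    (fun x => \prod_(j < 4) (if j != i then dyadic_kernel J (tH (t - x) j) else 1)).
  by apply/funext => x; exact: big_mkcond.
apply: measurable_prod => j _; case: (j != i) => //.
apply: measurableT_comp; first exact: measurable_dyadic_kernel.
under eq_fun do rewrite tHB.
by apply: measurable_funB => //; exact: measurable_tH.
Qed.

(** This trades the polyhedron for the whole space, where Tonelli applies; [G] will be [F] with a
    cutoff in each variable. *)
Lemma integral_OmegaH_le (F G : pt R -> R) (C : R) :
  measurable_fun setT G -> (forall x, 0 <= G x) ->
  (forall x, OmegaH x -> F x = G x) -> (\int[@mu3 R]_x (G x)%:E <= C%:E)%E ->
  (\int[@mu3 R]_(x in @OmegaH R) (F x)%:E <= C%:E)%E.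
Proof.
move=> mG G0 FG; apply: le_trans.
have -> : (\int[@mu3 R]_(x in @OmegaH R) (F x)%:E =
    \int[@mu3 R]_(x in @OmegaH R) (G x)%:E)%E.
  by apply: eq_integral => x; rewrite inE => /FG ->.
apply: ge0_subset_integral => //; first exact: measurable_OmegaH.
  exact/measurable_EFinP.
by move=> x _; rewrite lee_fin.
Qed.

(** If the omitted coordinate is among the first three, the kernel at the fourth coordinate is read
    as a kernel in the omitted variable, which is integrated innermost. If it is the fourth, the
    three kernels have separate variables. *)
Lemma integral_prod_dyadic_kernel_le J t i :
  (\int[@mu3 R]_(x in @OmegaH R)
     (\prod_(j < 4 | j != i) dyadic_kernel J (tH (t - x) j))%:E
   <= ((10 * J.+1%:R) ^+ 3)%:E)%E.
Proof.
set L : R := 10 * _.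
have m1 : measurable_fun setT (fun x : pt R => x.1.1) by exact: measurableT_comp.
have m2 : measurable_fun setT (fun x : pt R => x.1.2) by exact: measurableT_comp.
have m3 : measurable_fun setT (fun x : pt R => x.2) by exact: measurable_snd.
have n1 : measurable_fun setT (fun x : R * R => x.1) by exact: measurable_fst.
have n2 : measurable_fun setT (fun x : R * R => x.2) by exact: measurable_snd.
(* With [a], [b], [d] the first three coordinates of [x] in some order,
   [c (a, b) - d = - (t_4 - x_4)]; evenness of the kernel absorbs the sign. *)
pose c (p : R * R) : R := - (tH t o3 + p.1 + p.2).
have mc : measurable_fun setT c.
  rewrite /c; under eq_fun do rewrite -sub0r.
  apply: measurable_funB => //.
  by do 2? apply: measurable_funD.
pose h := @box_kernel R J.
have hE s j x : OmegaH x -> h s (tH x j) = dyadic_kernel J (s - tH x j).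
  by move=> xO; rewrite /h box_kernel_in // OmegaH_le1.
have o3E (x : pt R) (a b d : R) : a + b + d = - tH x o3 ->
    dyadic_kernel J (c (a, b) - d) = dyadic_kernel J (tH t o3 - tH x o3).
  by move=> abd; rewrite -dyadic_kernelN; congr dyadic_kernel; rewrite /c /=; lra.
have prodE x : \prod_(j < 4 | j != i) dyadic_kernel J (tH (t - x) j) =
    \prod_(j < 4) (if j != i then dyadic_kernel J (tH t j - tH x j) else 1).
  rewrite big_mkcond.
  by apply: eq_bigr => j _; rewrite tHB.
have L3 : L ^+ 3 = L * L * L by ring.
have L3' : L ^+ 3 = L * (L * L) by ring.
have mh (s u : pt R -> R) : measurable_fun setT s -> measurable_fun setT u ->
  measurable_fun setT (fun x => h (s x) (u x)) by exact: measurable_box_kernel.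
have h0 s u : 0 <= h s u by exact: box_kernel_ge0.
have K1 x : OmegaH x -> h (tH t ord0) x.1.1 = dyadic_kernel J (tH t ord0 - tH x ord0).
  exact: (hE _ ord0).
have K2 x : OmegaH x -> h (tH t o1) x.1.2 = dyadic_kernel J (tH t o1 - tH x o1).
  exact: (hE _ o1).
have K3 x : OmegaH x -> h (tH t o2) x.2 = dyadic_kernel J (tH t o2 - tH x o2).
  exact: (hE _ o2).
move: i prodE; apply: forall_I4 => prodE.
- apply: (integral_OmegaH_le (G := fun z : pt R =>
      h (tH t o2) z.2 * (h (tH t o1) z.1.2 * h (c (z.1.2, z.2)) z.1.1))).
  + apply: measurable_funM; first exact: mh.
    apply: measurable_funM; first exact: mh.
    apply: mh => //; apply: measurableT_comp => //; exact: measurable_fun_pair.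
  + by move=> x; rewrite !(h0, mulr_ge0).
  + move=> x xO; rewrite prodE prod_I4 /= K2 // K3 //.
    rewrite (hE _ ord0) // (o3E x); last by rewrite /tH /=; ring.
    by ring.
  by rewrite L3'; exact: integral_box_kernel3_le321.
- apply: (integral_OmegaH_le (G := fun z : pt R =>
      h (tH t o2) z.2 * (h (tH t ord0) z.1.1 * h (c (z.1.1, z.2)) z.1.2))).
  + apply: measurable_funM; first exact: mh.
    apply: measurable_funM; first exact: mh.
    apply: mh => //; apply: measurableT_comp => //; exact: measurable_fun_pair.
  + by move=> x; rewrite !(h0, mulr_ge0).
  + move=> x xO; rewrite prodE prod_I4 /= K1 // K3 //.
    rewrite (hE _ o1) // (o3E x); last by rewrite /tH /=; ring.
    by ring.
  by rewrite L3'; exact: integral_box_kernel3_le312.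
- apply: (integral_OmegaH_le (G := fun z : pt R =>
      h (tH t ord0) z.1.1 * h (tH t o1) z.1.2 * h (c z.1) z.2)).
  + apply: measurable_funM; first by apply: measurable_funM; exact: mh.
    by apply: mh => //; exact: measurableT_comp.
  + by move=> x; rewrite !(h0, mulr_ge0).
  + move=> [[x1 x2] x3] xO; rewrite prodE prod_I4 /= (K1 _ xO) (K2 _ xO).
    rewrite (hE _ o2 _ xO) (o3E ((x1, x2), x3)); last by rewrite /tH /=; ring.
    by ring.
  by rewrite L3; exact: integral_box_kernel3_le123.
- apply: (integral_OmegaH_le (G := fun z : pt R =>
      h (tH t ord0) z.1.1 * h (tH t o1) z.1.2 * h (tH t o2) z.2)).
  + by apply: measurable_funM; [apply: measurable_funM|]; exact: mh.
  + by move=> x; rewrite !(h0, mulr_ge0).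
  + by move=> x xO; rewrite prodE prod_I4 /= K1 // K2 // K3 // mulr1.
  by rewrite L3; exact: (integral_box_kernel3_le123 _ _ _ (c := fun=> tH t o2)).
Qed.

Lemma integral_kernel_majorant_le J t :
  (\int[@mu3 R]_(x in @OmegaH R) (kernel_majorant J (t - x))%:E
   <= (4 * (10 * J.+1%:R) ^+ 3)%:E)%E.
Proof.
have -> : (\int[@mu3 R]_(x in @OmegaH R) (kernel_majorant J (t - x))%:E =
    \sum_(i < 4) \int[@mu3 R]_(x in @OmegaH R)
      (\prod_(j < 4 | j != i) dyadic_kernel J (tH (t - x) j))%:E)%E.
  under eq_integral do rewrite /kernel_majorant -sumEFin.
  apply: ge0_integral_sum; first exact: measurable_OmegaH.
    move=> i; apply/measurable_EFinP; apply: measurable_funTS.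
    exact: measurable_prod_dyadic_kernel.
  move=> i x _; rewrite lee_fin; apply: prodr_ge0 => j _.
  exact: dyadic_kernel_ge0.
apply: le_trans (lee_sum _ (fun i _ => integral_prod_dyadic_kernel_le J t i)) _.
by rewrite sumEFin lee_fin sumr_const card_ord -[leLHS]mulr_natl.
Qed.

Lemma measurable_kernel_majorant J t :
  measurable_fun setT (fun x => kernel_majorant J (t - x)).
Proof. by apply: measurable_sum => i; exact: measurable_prod_dyadic_kernel. Qed.

End OmegaIntegral.

(** * Integration of complex-valued functions over the dodecahedron *)

Section ComplexIntegral.
Variable R : realType.
Local Notation mu := (@mu3 R).
Local Notation O := (@OmegaH R).

Definition cmeasurable (g : pt R -> R[i]) :=
  measurable_fun setT (fun x => complex.Re (g x)) /\
  measurable_fun setT (fun x => complex.Im (g x)).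

Lemma cmeasurableM (f g : pt R -> R[i]) :
  cmeasurable f -> cmeasurable g -> cmeasurable (fun x => f x * g x).
Proof.
move=> [f1 f2] [g1 g2]; split.
- have -> : (fun x => complex.Re (f x * g x)) = (fun x =>
      complex.Re (f x) * complex.Re (g x) - complex.Im (f x) * complex.Im (g x)).
    by apply/funext => x; case: (f x); case: (g x).
  by apply: measurable_funB; exact: measurable_funM.
- have -> : (fun x => complex.Im (f x * g x)) = (fun x =>
      complex.Re (f x) * complex.Im (g x) + complex.Im (f x) * complex.Re (g x)).
    by apply/funext => x; case: (f x); case: (g x).
  by apply: measurable_funD; exact: measurable_funM.
Qed.

Lemma integrable_OmegaH (u : pt R -> R) (B : R) : measurable_fun setT u ->
  (forall x, O x -> `|u x| <= B) -> mu.-integrable O (EFin \o u).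
Proof.
move=> mu_ uB; apply: measurable_bounded_integrable.
- exact: measurable_OmegaH.
- exact: mu3_OmegaH_lty.
- exact: measurable_funTS.
exists B; split; first exact: num_real.
by move=> y By x Ox; exact: le_trans (uB x Ox) (ltW By).
Qed.

Definition cintegrable (g : pt R -> R[i]) :=
  mu.-integrable O (fun x => (complex.Re (g x))%:E) /\
  mu.-integrable O (fun x => (complex.Im (g x))%:E).

Lemma cintegrable_OmegaH (g : pt R -> R[i]) (B : R) : cmeasurable g ->
  (forall x, O x -> modc (g x) <= B) -> cintegrable g.
Proof.
move=> [g1 g2] gB; split; apply: (@integrable_OmegaH _ B) => // x Ox.
- by rewrite (le_trans (normr_Re_le _)) ?gB.
- by rewrite (le_trans (normr_Im_le _)) ?gB.
Qed.

Lemma cintegrableD (f g : pt R -> R[i]) : cintegrable f -> cintegrable g ->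
  cintegrable (fun x => f x + g x).
Proof.
have mO := @measurable_OmegaH R.
move=> [f1 f2] [g1 g2]; split.
- have -> : (fun x => (complex.Re (f x + g x))%:E) =
    ((fun x => (complex.Re (f x))%:E) \+ (fun x => (complex.Re (g x))%:E))%E.
    by apply/funext => x /=; rewrite raddfD.
  exact: integrableD.
- have -> : (fun x => (complex.Im (f x + g x))%:E) =
    ((fun x => (complex.Im (f x))%:E) \+ (fun x => (complex.Im (g x))%:E))%E.
    by apply/funext => x /=; rewrite raddfD.
  exact: integrableD.
Qed.

Lemma cintD (f g : pt R -> R[i]) : cintegrable f -> cintegrable g ->
  cint O (fun x => f x + g x) = cint O f + cint O g.
Proof.
have mO := @measurable_OmegaH R.
move=> [f1 f2] [g1 g2]; rewrite /cint.
have -> : (fun x => complex.Re (f x + g x)) =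
    (fun x => complex.Re (f x) + complex.Re (g x)).
  by apply/funext => x; rewrite raddfD.
have -> : (fun x => complex.Im (f x + g x)) =
    (fun x => complex.Im (f x) + complex.Im (g x)).
  by apply/funext => x; rewrite raddfD.
by rewrite !RintegralD.
Qed.

Lemma cintMr (f : pt R -> R[i]) (w : R[i]) : cintegrable f ->
  cint O f * w = cint O (fun x => f x * w).
Proof.
have mO := @measurable_OmegaH R.
have iZ (u : pt R -> R) (r : R) : mu.-integrable O (fun x => (u x)%:E) ->
    mu.-integrable O (fun x => (u x * r)%:E).
  by move=> iu; under eq_fun do rewrite EFinM; exact: integrableZr.
move=> [f1 f2]; case: w => a b; rewrite /cint.
have -> : (fun x => complex.Re (f x * (a +i* b)%C)) =
    (fun x => complex.Re (f x) * a - complex.Im (f x) * b).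
  by apply/funext => x; case: (f x).
have -> : (fun x => complex.Im (f x * (a +i* b)%C)) =
    (fun x => complex.Re (f x) * b + complex.Im (f x) * a).
  by apply/funext => x; case: (f x).
by rewrite RintegralB ?RintegralD ?RintegralZr //; exact: iZ.
Qed.

Lemma cintegrableMr (f : pt R -> R[i]) (w : R[i]) : cintegrable f ->
  cintegrable (fun x => f x * w).
Proof.
have mO := @measurable_OmegaH R.
move=> [f1 f2]; case: w => a b; split.
- have -> : (fun x => (complex.Re (f x * (a +i* b)%C))%:E) =
    ((fun x => (complex.Re (f x))%:E * a%:E) \- (fun x => (complex.Im (f x))%:E * b%:E))%E.
    by apply/funext => x /=; case: (f x).
  by apply: integrableB => //; exact: integrableZr.
- have -> : (fun x => (complex.Im (f x * (a +i* b)%C))%:E) =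
    ((fun x => (complex.Re (f x))%:E * b%:E) \+ (fun x => (complex.Im (f x))%:E * a%:E))%E.
    by apply/funext => x /=; case: (f x).
  by apply: integrableD => //; exact: integrableZr.
Qed.

Lemma cint_sum (I : Type) (s : seq I) (g : I -> pt R -> R[i]) :
  (forall i, cintegrable (g i)) ->
  cintegrable (fun x => \sum_(i <- s) g i x) /\
  cint O (fun x => \sum_(i <- s) g i x) = \sum_(i <- s) cint O (g i).
Proof.
move=> ig; elim: s => [|i s [IHi IHE]].
  under eq_fun do rewrite big_nil; split.
    by split; exact: integrable0.
  by rewrite big_nil /cint Rintegral_cst ?mul0r //; exact: measurable_OmegaH.
under eq_fun do rewrite big_cons; split; first exact: cintegrableD.
by rewrite big_cons cintD // IHE.
Qed.

Lemma normr_Rintegral_le (u K : pt R -> R) (M C : R) :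
  mu.-integrable O (fun x => (u x)%:E) -> measurable_fun setT K -> 0 <= M ->
  (forall x, 0 <= K x) ->
  (forall x, O x -> `|u x| <= M * K x) ->
  (\int[mu]_(x in O) (K x)%:E <= C%:E)%E ->
  `|Rintegral mu O u| <= M * C.
Proof.
move=> iu mK M0 K0 uK KC; have mO := @measurable_OmegaH R.
apply: (le_trans (le_normr_Rintegral (mu := mu) (f := u) mO iu)).
have /integrableP[mu_ _] := iu.
have h : (\int[mu]_(x in O) (`|u x|)%:E <= (M * C)%:E)%E.
  apply: (@le_trans _ _ (\int[mu]_(x in O) (M%:E * (K x)%:E))%E).
    apply: ge0_le_integral => [|x _|||x Ox].
    - exact: mO.
    - by rewrite lee_fin.
    - by apply/measurable_EFinP/measurableT_comp => //; exact/measurable_EFinP.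
    - apply: emeasurable_funM => //; apply: measurable_funTS.
      exact/measurable_EFinP.
    - by rewrite lee_fin uK.
  rewrite ge0_integralZl_EFin //.
  - by rewrite EFinM lee_wpmul2l // lee_fin.
  - by move=> x _; rewrite lee_fin.
  - by apply: measurable_funTS; exact/measurable_EFinP.
rewrite -lee_fin; apply: (le_trans _ h); rewrite /Rintegral.
(* [fine] sends infinite values to 0, so the comparison requires finiteness of the integral, which
   [h] provides. *)
set I := (X in (fine X)%:E); rewrite fineK // ge0_fin_numE.
  exact: le_lt_trans h (ltry _).
by apply: integral_ge0 => x _; rewrite lee_fin.
Qed.

(** The factor 2 comes from estimating the real and imaginary parts separately. *)
Lemma modc_cint_le (g : pt R -> R[i]) (K : pt R -> R) (M C : R) :
  cintegrable g -> measurable_fun setT K -> 0 <= M -> (forall x, 0 <= K x) ->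
  (forall x, O x -> modc (g x) <= M * K x) ->
  (\int[mu]_(x in O) (K x)%:E <= C%:E)%E ->
  modc (cint O g) <= 2 * (M * C).
Proof.
move=> [g1 g2] mK M0 K0 gK KC; apply: le_trans (modc_le _) _.
rewrite mulr_natl mulr2n lerD //=; apply: (normr_Rintegral_le (K := K)) => // x Ox.
- exact: le_trans (normr_Re_le _) (gK x Ox).
- exact: le_trans (normr_Im_le _) (gK x Ox).
Qed.

End ComplexIntegral.

(** * The partial sum as a convolution, and the final estimate *)

Section PartialSum.
Variable R : realType.
Implicit Types (t x : pt R) (k : ivec).

Lemma cmeasurable_phiH k : cmeasurable (@phiH R k).
Proof.
have mdot : measurable_fun setT (fun x : pt R => pi / 2 * dotH k x).
  apply: measurable_funM => //; apply: measurable_sum => i.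
  by apply: measurable_funM => //; exact: measurable_tH.
split => /=.
- apply: measurableT_comp mdot.
  by apply: continuous_measurable_fun; exact: continuous_cos.
- apply: measurableT_comp mdot.
  by apply: continuous_measurable_fun; exact: continuous_sin.
Qed.

Lemma cmeasurable_conjc (g : pt R -> R[i]) :
  cmeasurable g -> cmeasurable (fun x => Defs.conjc (g x)).
Proof.
move=> [g1 g2]; split => //.
have -> : (fun x => complex.Im (Defs.conjc (g x))) = (fun x => 0 - complex.Im (g x)).
  by apply/funext => x; rewrite sub0r.
exact: measurable_funB.
Qed.

Lemma conjc_phiHM k t x : Defs.conjc (phiH k x) * phiH k t = phiH k (t - x).
Proof.
have dB : dotH k (t - x) = dotH k t - dotH k x.
  by rewrite /dotH -sumrB; apply: eq_bigr => i _; rewrite tHB mulrBr.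
rewrite /phiH dB mulrBr addrC cexpiD; congr (_ * _).
by rewrite /cexpi /Defs.conjc /= cosN sinN.
Qed.

(** The normalization 1/2 cancels the Jacobian 2 of the parametrization. *)
Lemma innerHE (f g : pt R -> R[i]) :
  innerH f g = cint (@OmegaH R) (fun x => f x * Defs.conjc (g x)).
Proof.
rewrite /innerH /integralH mulrA -rmorphM /= div1r mulVf ?rmorph1 ?mul1r //.
Qed.

(** The partial sum is the convolution of [f] with the Dirichlet kernel: the finite sum moves inside
    the integral, each term being bounded and measurable on a set of finite measure. *)
Lemma SnE n (f : pt R -> R[i]) (M : R) t : cmeasurable f ->
  (forall x, OmegaH x -> modc (f x) <= M) ->
  let g x := f x * \sum_(k <- ibox n | inHstar n k) phiH k (t - x) in
  cintegrable g /\ Sn n f t = cint (@OmegaH R) g.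
Proof.
move=> mf fM g.
pose gk k x := f x * Defs.conjc (phiH k x) * phiH k t.
have igk k : cintegrable (fun x => f x * Defs.conjc (phiH k x)).
  apply: (@cintegrable_OmegaH _ _ M).
    by apply: cmeasurableM => //; exact/cmeasurable_conjc/cmeasurable_phiH.
  move=> x Ox; rewrite modcM.
  have -> : modc (Defs.conjc (phiH k x)) = 1.
    by rewrite /modc /= sqrrN cos2Dsin2 sqrtr1.
  by rewrite mulr1 fM.
have gE : g = (fun x => \sum_(k <- [seq k <- ibox n | inHstar n k]) gk k x).
  apply/funext => x; rewrite /g mulr_sumr -[LHS]big_filter.
  by apply: eq_bigr => k _; rewrite /gk -mulrA conjc_phiHM.
have [ig cE] := cint_sum [seq k <- ibox n | inHstar n k]
  (fun k => cintegrableMr (phiH k t) (igk k)).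
rewrite gE; split; first exact: ig.
apply: etrans (esym cE); rewrite /Sn -[LHS]big_filter.
by apply: eq_bigr => k _; rewrite innerHE cintMr.
Qed.

(** Take [J = l + 1] with [l] the integer part of the binary logarithm of [n]. As [n >= 2] gives
    [l >= 1], one has [J + 1 = l + 2 <= 3 l], and [l <= ln n / ln 2]. *)
Lemma ln_dyadic n : (2 <= n)%N -> exists2 J, (n.+1 <= 2 ^ J)%N &
  10 * J.+1%:R <= 30 / ln 2 * ln (n%:R : R).
Proof.
move=> n2; pose l := trunc_log 2 n.
have /andP[ln1 ln2] := trunc_log_bounds (isT : (1 < 2)%N) (ltnW n2).
exists l.+1 => //.
have l1 : (1 <= l)%N by rewrite trunc_log_gt0 n2.
have ln2_gt0 : 0 < ln 2 :> R by rewrite ln_gt0 // ltr1n.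
have h : l%:R * ln 2 <= ln (n%:R : R).
  rewrite mulr_natl -lnXn // ler_ln ?posrE ?exprn_gt0 ?ltr0n ?(ltnW n2) //.
  by rewrite -natrX ler_nat.
have h3 : l.+2%:R <= 3 * l%:R :> R by rewrite -natrM ler_nat; lia.
have h4 : l%:R <= ln n%:R / ln 2 :> R by rewrite ler_pdivlMr.
apply: (@le_trans _ _ (30 * l%:R)); first by lra.
by rewrite mulrAC -mulrA ler_wpM2l.
Qed.

End PartialSum.

Theorem theorem3p11 (R : realType) :
  exists c : R, forall n : nat, (2 <= n)%N ->
    forall f : pt R -> R[i],
      Hperiodic f ->
      continuous (fun x => complex.Re (f x)) -> continuous (fun x => complex.Im (f x)) ->
      forall M : R, (forall x, closure (@OmegaH R) x -> modc (f x) <= M) ->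
      forall t, closure (@OmegaH R) t ->
        modc (Sn n f t) <= c * (ln (n%:R : R)) ^+ 3 * M.
Proof.
(* Here 8 is 2, for the real and imaginary parts, times 4, for the omitted coordinates; the cube is
   that of the one-dimensional bound in [ln_dyadic]. *)
exists (8 * (30 / ln 2) ^+ 3) => n n2 f _ cRe cIm M fM t Ot.
have [J nJ Jn] := ln_dyadic R n2.
have M0 : 0 <= M := le_trans (modc_ge0 _) (fM _ Ot).
have mf : cmeasurable f by split; exact: continuous_measurable3.
have fM' x : OmegaH x -> modc (f x) <= M.
  by move=> Ox; apply: fM; exact: subset_closure.
have [ig ->] := SnE n t mf fM'.
apply: le_trans (modc_cint_le (K := fun x => kernel_majorant J (t - x)) ig _ M0 _ _
  (integral_kernel_majorant_le J t)) _.
- exact: measurable_kernel_majorant.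
- by move=> x; exact: kernel_majorant_ge0.
- move=> x Ox; rewrite modcM ler_pM ?modc_ge0 ?fM' //.
  exact: modc_sum_phiH.
set L := ln n%:R in Jn *.
have J3 : (10 * J.+1%:R) ^+ 3 <= (30 / ln 2 * L) ^+ 3.
  have J0 : 0 <= 10 * J.+1%:R :> R by rewrite mulr_ge0.
  by apply: lerXn2r; rewrite ?nnegrE // (le_trans J0).
rewrite exprMn in J3; nra.
Qed.
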